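(* Fix an integer $d\ge 7$. There is a constant $C_d>0$ such that, for all sufficiently large integers $q$, \[ 0\le \alpha_q(d)-\frac1q\binom{q+d-1}{d}\le C_d\,q^{d-4}. \] Equivalently, as $q\to\infty$, \[ \alpha_q(d)=\frac{q^{d-1}}{d!}+\frac{q^{d-2}}{2(d-2)!}+\frac{3d^2-7d+2}{24(d-2)!}\,q^{d-3}+O_d(q^{d-4}). \] The upper bound is certified by giving every upward clique $a+\Delta_q(1)$, $a\in\Delta_q(d-1)$, the weight $w_\lambda$ determined by the type $\lambda$ of its anchor $a$: \[ w_\lambda= \begin{cases} \displaystyle\frac1d,&\lambda=1^{d-1},\\[4pt] \displaystyle\frac{d-1}{d(d-2)},&\lambda=2\,1^{d-3},\\[4pt] \displaystyle\frac{d^2-3d+1}{d(d-2)(d-3)},&\lambda=3\,1^{d-4},\\[4pt] \displaystyle\frac{d^2-4d+2}{d(d-2)(d-4)},&\lambda=2^2\,1^{d-5},\\[4pt] 1,&\text{otherwise.} \end{cases} \] These weights form a fractional tile cover, i.e. they are nonnegative and every $x\in\Delta_q(d)$ lies in upward cliques of total weight at least $1$ (and their total weight is an upper bound for $\alpha_q(d)$ that is at most $\frac1q\binom{q+d-1}{d}+C_dq^{d-4}$ for all sufficiently large $q$).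
   Context: For integers $q\ge 2$, $d\ge 0$, let $\Delta_q(d)=\{a\in\mathbb Z_{\ge0}^q:\sum_{i=1}^q a_i=d\}$, and let $e_1,\dots,e_q$ be the standard unit vectors of $\mathbb Z^q$. The graph $G_q(d)$ has vertex set $\Delta_q(d)$; distinct $a,b\in\Delta_q(d)$ are adjacent exactly when $a-b=e_i-e_j$ for some $i\ne j$. Write $\alpha_q(d)=\alpha(G_q(d))$ for its independence number. For $a\in\Delta_q(d-1)$, the upward clique with anchor $a$ is $a+\Delta_q(1)=\{a+e_i:1\le i\le q\}\subseteq\Delta_q(d)$, which induces a complete graph $K_q$. The type of a vector in $\mathbb Z_{\ge 0}^q$ is the integer partition formed by its positive coordinates; $s^k$ denotes $k$ parts equal to $s$, so for example $2^2\,1^{d-5}$ is the partition of $d-1$ with two parts equal to $2$ and $d-5$ parts equal to $1$. *)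

(* Defs.v *)
From mathcomp Require Import all_boot all_order all_algebra.
From mathcomp Require Import reals.

Set Implicit Arguments.
Unset Strict Implicit.
Unset Printing Implicit Defensive.

Import Order.TTheory GRing.Theory Num.Theory.

Local Open Scope ring_scope.

Section Graph.
Variables (T : finType) (e : rel T).

Definition independent (S : {set T}) : bool :=
  [forall x in S, forall y in S, ~~ e x y].

Definition independence_number : nat :=
  (\max_(S : {set T} | independent S) #|S|)%N.

End Graph.

(* Coordinates of a nonnegative vector with sum d are at most d, so bounding
   them by d loses nothing and makes the type finite. *)
Definition Delta (q d : nat) : Type :=
  {a : {ffun 'I_q -> 'I_d.+1} | (\sum_(i < q) a i)%N == d}.

Definition coord (q d : nat) (a : Delta q d) (i : 'I_q) : nat := val a i.

Definition vec (q d : nat) (a : Delta q d) : 'rV[int]_q :=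
  \row_(i < q) (coord a i)%:Z.

Definition unit_vec (q : nat) (i : 'I_q) : 'rV[int]_q := delta_mx 0 i.

Definition G (q d : nat) : rel (Delta q d) := fun a b =>
  (a != b) &&
  [exists i : 'I_q, exists j : 'I_q,
     (i != j) && (vec a - vec b == unit_vec i - unit_vec j)].

Definition alpha (q d : nat) : nat := independence_number (@G q d).

(* Meaningful for d > 0 only; anchors have coordinate sum d - 1. *)
Definition upward_clique (q d : nat) (a : Delta q d.-1) : {set Delta q d} :=
  [set x | [exists i : 'I_q, vec x == vec a + unit_vec i]].

(* Integer partitions are represented as nonincreasing sequences of positive
   integers. *)
Definition vtype (q d : nat) (a : Delta q d) : seq nat :=
  sort geq [seq k <- [seq coord a i | i <- enum 'I_q] | (0 < k)%N].

(* The four listed types are pairwise distinct for d >= 5, so the order of the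
   tests is immaterial there. *)
Definition weight (R : realType) (d : nat) (la : seq nat) : R :=
  let D : R := d%:R in
  if la == nseq (d - 1) 1%N then 1 / D
  else if la == 2%N :: nseq (d - 3) 1%N then (D - 1) / (D * (D - 2))
  else if la == 3%N :: nseq (d - 4) 1%N then
    (D ^+ 2 - 3 * D + 1) / (D * (D - 2) * (D - 3))
  else if la == 2%N :: 2%N :: nseq (d - 5) 1%N then
    (D ^+ 2 - 4 * D + 2) / (D * (D - 2) * (D - 4))
  else 1.

Definition clique_weight (R : realType) (q d : nat) (a : Delta q d.-1) : R :=
  weight R d (vtype a).

Definition fractional_tile_cover (R : realType) (q d : nat)
    (w : Delta q d.-1 -> R) : Prop :=
  (forall a, 0 <= w a) /\
  (forall x : Delta q d, 1 <= \sum_(a | x \in upward_clique a) w a).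

Definition total_weight (R : realType) (q d : nat)
    (w : Delta q d.-1 -> R) : R := \sum_a w a.

(* Main.v *)
Require Import Defs.
From mathcomp Require Import all_boot all_order all_algebra.
From mathcomp Require Import all_classical reals topology normedtype landau.
From mathcomp Require Import zify ring lra.

(** Colouring x by sum_i i * x_i modulo q is proper, so some colour class has at
    least |Delta_q(d)| / q elements; this is the lower bound.  For the upper
    bound, write cov(x) for the total weight of the upward cliques through x.
    It depends only on the type of x, is at least 1 and at most d, and equals 1
    as soon as x has at least d - 2 positive coordinates.  As each upward clique
    has q elements, q times the total weight is the sum of all cov(x); hence the
    total weight exceeds |Delta_q(d)| / q by at most d / q times the number of x
    with at most d - 3 positive coordinates, which is O(q^(d-3)).  No anchors of
    a given type need to be counted.  The expansion comes from
    |Delta_q(d)| / q = (q + 1) ... (q + d - 1) / d!. *)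

Set Implicit Arguments.
Unset Strict Implicit.
Unset Printing Implicit Defensive.

Import Order.TTheory GRing.Theory Num.Theory.
Import numFieldNormedType.Exports.

Local Open Scope ring_scope.
Local Open Scope classical_set_scope.

(* [coord] alone would denote the coordinates of [vector]. *)
Local Notation coord := Defs.coord.

(** * Vectors with given sum, their types, and adjacency in coordinates *)

Section Delta.
Variables (q d : nat).
Implicit Types x y : Delta q d.

Lemma sum_coord x : (\sum_i coord x i)%N = d.
Proof. by rewrite -[RHS](eqP (valP x)). Qed.

Lemma coord_inj x y : coord x =1 coord y -> x = y.
Proof. by move=> e; apply/val_inj/ffunP => i; apply/val_inj/e. Qed.

Lemma Delta_of (f : 'I_q -> nat) :
  (\sum_i f i)%N = d -> exists x : Delta q d, coord x =1 f.
Proof.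
move=> fd; have fle i : (f i < d.+1)%N by rewrite ltnS -fd (bigD1 i) ?leq_addr.
pose g := [ffun i => Ordinal (fle i)].
have gd : (\sum_(i < q) g i)%N == d.
  by rewrite -[X in _ == X]fd; apply/eqP/eq_bigr => i _; rewrite ffunE.
by exists (Sub g gd) => i; rewrite /Defs.coord SubK ffunE.
Qed.

Lemma sumn_vtype x : sumn (vtype x) = d.
Proof.
rewrite (perm_sumn (permEl (perm_sort _ _))) sumnE big_filter big_map big_enum_cond /=.
rewrite -[RHS](sum_coord x) [RHS](bigID (fun i => 0 < coord x i)%N) /=.
rewrite [X in (_ + X)%N]big1 ?addn0// => i.
by rewrite lt0n negbK => /eqP.
Qed.

Lemma vtype_sorted x : sorted geq (vtype x).
Proof. by apply: sort_sorted => m n; exact: leq_total. Qed.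

Lemma vtype_gt0 x : all (ltn 0) (vtype x).
Proof. by rewrite all_sort filter_all. Qed.

Lemma size_vtype x : size (vtype x) = #|[pred i | 0 < coord x i]%N|.
Proof. by rewrite size_sort size_filter count_map -sum1_count big_enum_cond sum1_card. Qed.

(** Moving the negative terms across turns the integer identity x - y = e_i - e_j into one between
    natural numbers, free of truncated subtraction. *)
Lemma adjacentP x y :
  reflect (exists i j, i != j /\
             forall k, coord x k + (j == k) = coord y k + (i == k))%N
          (G x y).
Proof.
apply: (iffP andP) => [[_ /existsP[i /existsP[j /andP[ij /eqP e]]]]|[i [j [ij e]]]].
  exists i, j; split=> // k; move/rowP: e => /(_ k); rewrite !mxE eqxx /=.
  by rewrite ![k == _]eq_sym; case: eqP; case: eqP => _ _ /=; lia.
split.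
  apply: contraNneq ij => xy; have := e i; rewrite xy eqxx eq_sym.
  by case: eqP => // _; lia.
apply/existsP; exists i; apply/existsP; exists j; rewrite ij; apply/eqP/rowP => k.
have := e k; rewrite !mxE eqxx /= ![k == _]eq_sym.
by case: eqP; case: eqP => _ _ /=; lia.
Qed.

End Delta.

(** Listing the coordinates identifies these vectors with the tuples counted by
    [card_ord_partitions]. *)
Lemma card_Delta (m d : nat) : #|{: Delta m.+1 d}| = 'C(m + d, d).
Proof.
rewrite -[RHS]bin_sub ?leq_addl// addnK -(card_ord_partitions m d).
pose f (x : Delta m.+1 d) := [tuple val x i | i < m.+1].
have f_inj : injective f.
  move=> x y e; apply: coord_inj => i.
  by move/(congr1 (fun t => tnth t i)): e; rewrite !tnth_mktuple => /(congr1 val).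
rewrite -(fintype.card_image f_inj); apply: eq_card => t; rewrite inE.
apply/fintype.imageP/eqP => [[x _ ->]|td].
  by rewrite big_map big_enum -[RHS](sum_coord x).
have [x xt] : exists x : Delta m.+1 d, coord x =1 (fun i => tnth t i).
  by apply: Delta_of; rewrite -[RHS]td big_tuple.
by exists x => //; apply: eq_from_tnth => i; rewrite tnth_mktuple; apply/val_inj/esym/xt.
Qed.

(** * Upward cliques, with anchors of sum [d] and vertices of sum [d.+1] *)

Section Cliques.
Variables (q d : nat).
Implicit Types (x y : Delta q d.+1) (a : Delta q d).

(* x = a + e_i *)
Definition steps a x i := [forall j, coord x j == coord a j + (i == j)]%N.

Lemma stepsP a x i :
  reflect (forall j, coord x j = coord a j + (i == j))%N (steps a x i).
Proof. exact: eqfunP. Qed.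

Lemma mem_upward_clique a x :
  (x \in @upward_clique q d.+1 a) = [exists i, steps a x i].
Proof.
rewrite inE; apply: eq_existsb => i; apply/eqP/stepsP => [e j|e].
  by move/rowP: e => /(_ j); rewrite !mxE eqxx /= eq_sym; case: eqP => _ /=; lia.
by apply/rowP => j; rewrite !mxE eqxx /= e eq_sym; case: eqP => _ /=; lia.
Qed.

Lemma steps_uniq a x i j : steps a x i -> steps a x j -> i = j.
Proof.
move=> /stepsP/(_ i) + /stepsP/(_ i); rewrite eqxx [j == i]eq_sym; case: eqP => // _.
lia.
Qed.

Lemma steps_gt0 a x i : steps a x i -> (0 < coord x i)%N.
Proof. by move/stepsP => ->; rewrite eqxx addn1. Qed.

(** Here and in [ex_step_down], existence and uniqueness are packed into one equality of predicates,
    so that sums over [steps] collapse by [big_pred1]. *)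
Lemma ex_step_up a i : exists x, forall y, steps a y i = (y == x).
Proof.
have [x ex] : exists x : Delta q d.+1, coord x =1 fun j => (coord a j + (i == j))%N.
  apply: Delta_of; rewrite big_split sum_coord /= (bigD1 i) //= eqxx big1 ?addn0 ?addn1//.
  by move=> j /negPf; rewrite eq_sym => ->.
exists x => y; apply/stepsP/eqP => [e|-> //].
by apply: coord_inj => j; rewrite e ex.
Qed.

Lemma ex_step_down x i : (0 < coord x i)%N ->
  exists a, forall b, steps b x i = (b == a).
Proof.
move=> xi; have [a ea] : exists a : Delta q d, coord a =1 fun j => (coord x j - (i == j))%N.
  apply: Delta_of; apply/eqP; rewrite -(eqn_add2r 1) [X in _ == X]addn1 -[X in _ == X](sum_coord x).
  rewrite (bigD1 i) //= [X in _ == X](bigD1 i) //= eqxx.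
  rewrite (eq_bigr (fun j => coord x j)); first by apply/eqP; lia.
  by move=> j /negPf; rewrite eq_sym => ->; rewrite subn0.
exists a => b; apply/stepsP/eqP => [e|-> j].
  by apply: coord_inj => j; rewrite ea e addnK.
by rewrite ea; case: eqP => [<-|_]; lia.
Qed.

Lemma upward_clique_adjacent a x y :
  x \in @upward_clique q d.+1 a -> y \in @upward_clique q d.+1 a ->
  x != y -> G x y.
Proof.
rewrite !mem_upward_clique => /existsP[i /stepsP xi] /existsP[j /stepsP yj] xy.
apply/adjacentP; exists i, j; split=> [|k]; last by rewrite xi yj; lia.
by apply: contraNneq xy => ij; apply/eqP/coord_inj => k; rewrite xi yj ij.
Qed.

End Cliques.

(** The type of x - e_i when x has type [s] and x_i = [k]: one part [k] is lowered, and the filter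
    drops it if it becomes 0. *)
Definition remove_unit (s : seq nat) k :=
  sort geq [seq j <- k.-1 :: rem k s | (0 < j)%N].

Lemma sort_geq_perm s t : sorted geq t -> perm_eq s t -> sort geq s = t.
Proof.
have tot : total geq by move=> m n; exact: leq_total.
have tr : transitive geq by move=> m n p /= /[swap]; exact: leq_trans.
have anti : antisymmetric geq by move=> m n; rewrite /= andbC => /anti_leq.
by move=> ts st; apply: (sorted_eq tr anti) => //; [exact: sort_sorted | rewrite perm_sort].
Qed.

(** * Double counting of the incidences between anchors and vertices *)

Section DoubleCounting.
Variables (q d : nat).
Implicit Types (x y : Delta q d.+1) (a : Delta q d).

Lemma vtype_step a x i : steps a x i ->
  vtype a = remove_unit (vtype x) (coord x i).
Proof.
move=> ax; have /stepsP e := ax.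
(* [P] collects the positive coordinates away from [i], which [a] and [x] share; each type is [P]
   with at most one more part. *)
pose P := [seq k <- [seq coord a j | j <- rem i (enum 'I_q)] | (0 < k)%N].
have ienum : perm_eq (enum 'I_q) (i :: rem i (enum 'I_q)).
  by apply: perm_to_rem; rewrite mem_enum.
have xP : perm_eq (vtype x) (coord x i :: P).
  rewrite perm_sort (permPl (perm_filter _ (perm_map _ ienum))) /= (steps_gt0 ax).
  suff -> : [seq coord x j | j <- rem i (enum 'I_q)] = [seq coord a j | j <- rem i (enum 'I_q)].
    exact: perm_refl.
  apply/eq_in_map => j; rewrite mem_rem_uniq ?enum_uniq// !inE => /andP[/negPf ji _].
  by rewrite e eq_sym ji addn0.
have ai : (coord x i).-1 = coord a i by rewrite e eqxx addn1.
apply: sort_geq_perm; first by apply: sort_sorted => m n; exact: leq_total.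
rewrite /remove_unit perm_sym perm_sort perm_sym.
rewrite (permPl (perm_filter _ (perm_map _ ienum))) /= -ai perm_sym.
have remP : perm_eq (rem (coord x i) (vtype x)) P.
  rewrite -(perm_cons (coord x i)) -(permPr xP) perm_sym perm_to_rem//.
  by rewrite (perm_mem xP) inE eqxx.
have := perm_filter (fun k => 0 < k)%N remP; rewrite [X in perm_eq _ X]filter_id => H.
by case: ifP => _; rewrite ?perm_cons.
Qed.

Variable R : nmodType.

(** An anchor reaches [x] in a single direction, by [steps_uniq], so splitting by direction counts
    it once. *)
Lemma sum_anchors (F : Delta q d -> R) x :
  \sum_(a | x \in @upward_clique q d.+1 a) F a =
  \sum_i \sum_(a | steps a x i) F a.
Proof.
rewrite (exchange_big_dep xpredT) //= big_mkcond; apply: eq_bigr => a _.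
rewrite mem_upward_clique; case: existsP => [[i axi]|nax].
  by rewrite (big_pred1 i) // => j; apply/idP/eqP => [axj|->//]; exact: steps_uniq axj axi.
by rewrite big_pred0// => i; apply/negP => axi; apply: nax; exists i.
Qed.

(** Direction i contributes one anchor if x_i > 0 and none otherwise; hence the sum depends on [x]
    through its type alone. *)
Lemma sum_anchors_vtype (F : seq nat -> R) x :
  \sum_(a | x \in @upward_clique q d.+1 a) F (vtype a) =
  \sum_(k <- vtype x) F (remove_unit (vtype x) k).
Proof.
rewrite sum_anchors (perm_big _ (permEl (perm_sort _ _))) big_filter big_map.
rewrite big_enum_cond /= [RHS]big_mkcond; apply: eq_bigr => i _.
case: ifPn => [xi|]; last first.
  by move=> xi; rewrite big_pred0// => a; apply: contraNF xi => /steps_gt0.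
have [a ea] := ex_step_down xi; rewrite (big_pred1 a) //.
by rewrite (@vtype_step a x i) // ea.
Qed.

Lemma sum_cliques (F : Delta q d -> R) :
  \sum_x \sum_(a | x \in @upward_clique q d.+1 a) F a = (\sum_a F a) *+ q.
Proof.
under eq_bigr do rewrite sum_anchors.
transitivity (\sum_(i < q) \sum_a F a); last by rewrite sumr_const card_ord.
rewrite exchange_big; apply: eq_bigr => i _.
rewrite (exchange_big_dep xpredT) //=; apply: eq_bigr => a _.
by have [x ex] := ex_step_up a i; rewrite (big_pred1 x).
Qed.

End DoubleCounting.

(** * Partitions of [d] with at least [d - 2] parts *)

Section Types.
Local Open Scope nat_scope.

Lemma size_le_sumn s : all (ltn 0) s -> size s <= sumn s.
Proof. by elim: s => //= k s IH /andP[k0 /IH]; lia. Qed.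

Lemma sumn_le_size s : all (geq 1) s -> sumn s <= size s.
Proof. by elim: s => //= k s IH /andP[k1 /IH]; lia. Qed.

Lemma nseq1_of_sumn s : all (ltn 0) s -> sumn s <= size s -> s = nseq (size s) 1.
Proof.
elim: s => //= k s IH /andP[k0 s0] le_s; have szs := size_le_sumn s0.
by rewrite -IH //; [congr cons; lia | lia].
Qed.

Lemma path_geq1 k s : path geq k s -> k <= 1 -> sumn s <= size s.
Proof.
have tr : transitive geq by move=> m n p /= /[swap]; exact: leq_trans.
move=> ks k1; apply: sumn_le_size; apply: sub_all (order_path_min tr ks) => j /= jk.
exact: leq_trans jk k1.
Qed.

(** Lowering every part by 1 leaves a partition of [d - size s], which is at most 2: the empty one,
    1, 2 or 1 + 1. *)
Lemma partition_cases d s : sorted geq s -> all (ltn 0) s -> sumn s = d ->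
  d - 2 <= size s ->
  [\/ s = nseq d 1, s = 2 :: nseq (d - 2) 1, s = 3 :: nseq (d - 3) 1
    | s = [:: 2, 2 & nseq (d - 4) 1]].
Proof.
case: s => [|k s] /=; first by move=> _ _ <- _; constructor 1.
move=> ks /andP[k0 s0] sd sz; have szs := size_le_sumn s0.
have [k1|k1] := leqP k 1.
  have ss := path_geq1 ks k1.
  by constructor 1; rewrite (nseq1_of_sumn s0 ss) (_ : d = (size s).+1) /=; [congr cons|]; lia.
have [k2|k2] := leqP k 2; last first.
  have ss : sumn s <= size s by lia.
  by constructor 3; rewrite (nseq1_of_sumn s0 ss); congr (_ :: nseq _ _); lia.
have {k1 k2}e2 : k = 2 by lia.
subst k; have [ss|ss] := leqP (sumn s) (size s).
  by constructor 2; rewrite (nseq1_of_sumn s0 ss); congr (_ :: nseq _ _); lia.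
case: s ks s0 sd sz szs ss => //= k s /andP[k2 ks] /andP[_ s0] sd sz szs ss.
have szs' := size_le_sumn s0.
have [k1|k1] := leqP k 1; first by have := path_geq1 ks k1; lia.
have ss' : sumn s <= size s by lia.
by constructor 4; rewrite (nseq1_of_sumn s0 ss'); congr [:: _, _ & nseq _ _]; lia.
Qed.

End Types.

(** * Effect of removing a unit on these partitions *)

Section RemoveUnit.
Local Open Scope nat_scope.

Lemma sorted_cons_nseq1 k n : 0 < k -> sorted geq (k :: nseq n 1).
Proof. by move=> k0; elim: n k k0 => //= n IH k ->; exact: (IH 1). Qed.

Lemma filter_nseq1 n : [seq j <- nseq n 1 | 0 < j] = nseq n 1.
Proof. by rewrite filter_nseq mul1n. Qed.

Lemma remove_unit_nseq1 n : remove_unit (nseq n.+1 1) 1 = nseq n 1.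
Proof.
rewrite /remove_unit /= filter_nseq1; apply: sort_geq_perm => //.
by case: n => // n; exact: sorted_cons_nseq1.
Qed.

Lemma remove_unit_one k n : 1 < k ->
  remove_unit (k :: nseq n.+1 1) 1 = k :: nseq n 1.
Proof.
move=> k1; rewrite /remove_unit /= gtn_eqF //= filter_nseq1 (ltnW k1).
by apply: sort_geq_perm => //; rewrite sorted_cons_nseq1 // ltnW.
Qed.

Lemma remove_unit_head k n : 1 < k ->
  remove_unit (k :: nseq n 1) k = k.-1 :: nseq n 1.
Proof.
case: k => [|[|k]] // _; rewrite /remove_unit /= eqxx filter_nseq1.
by apply: sort_geq_perm => //; rewrite sorted_cons_nseq1.
Qed.

Lemma remove_unit_22_one n :
  remove_unit [:: 2, 2 & nseq n.+1 1] 1 = [:: 2, 2 & nseq n 1].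
Proof.
rewrite /remove_unit /= filter_nseq1; apply: sort_geq_perm => //.
exact: (@sorted_cons_nseq1 2).
Qed.

Lemma remove_unit_22_two n :
  remove_unit [:: 2, 2 & nseq n 1] 2 = 2 :: nseq n.+1 1.
Proof.
rewrite /remove_unit /= filter_nseq1.
by apply: sort_geq_perm; [exact: (@sorted_cons_nseq1 2 n.+1)|rewrite (perm_catCA [:: 1] [:: 2])].
Qed.

(** Only a part equal to 1 disappears when lowered. This is an inequality because zeros in [s] would
    be filtered out too. *)
Lemma size_remove_unit s k : k \in s ->
  size (remove_unit s k) <= size s - (k == 1).
Proof.
move=> ks; have s_gt0 : 0 < size s by case: s ks.
rewrite size_sort size_filter /=.
apply: leq_trans (leq_add (leqnn _) (count_size _ _)) _.
by rewrite size_rem //; case: k ks => [|[|k]] ks /=; move: (size s) s_gt0 => n; lia.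
Qed.

End RemoveUnit.

(** * The weights and the coverage of each type *)

Section Weights.
Variables (R : realType) (d : nat).
Hypothesis d_ge7 : (7 <= d)%N.
Local Notation D := (d%:R : R).

Lemma weight_1 : weight R d (nseq (d - 1) 1%N) = 1 / D.
Proof. by rewrite /weight eqxx. Qed.

Lemma weight_2 : weight R d (2%N :: nseq (d - 3) 1%N) = (D - 1) / (D * (D - 2)).
Proof. by case: d d_ge7 => [|[|[|n]]] // _; rewrite /weight eqxx. Qed.

Lemma weight_3 : weight R d (3%N :: nseq (d - 4) 1%N) =
  (D ^+ 2 - 3 * D + 1) / (D * (D - 2) * (D - 3)).
Proof. by case: d d_ge7 => [|[|[|n]]] // _; rewrite /weight eqxx. Qed.

Lemma weight_22 : weight R d [:: 2, 2 & nseq (d - 5) 1]%N =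
  (D ^+ 2 - 4 * D + 2) / (D * (D - 2) * (D - 4)).
Proof. by case: d d_ge7 => [|[|[|[|[|n]]]]] // _; rewrite /weight eqxx. Qed.

(** The four listed types have d - 1, d - 2, d - 3 and d - 3 parts. *)
Lemma weight_small s : (size s <= d - 4)%N -> weight R d s = 1.
Proof.
move=> sz; rewrite /weight; do 4 (case: eqP => [es|_]; 
  first by move: sz; rewrite es /= size_nseq; lia).
by [].
Qed.

Lemma weight_itv s : 0 <= weight R d s <= 1.
Proof.
have D7 : 7 <= D by rewrite ler_nat.
have D2 : 0 < D - 2 by lra.
have D3 : 0 < D - 3 by lra.
have D4 : 0 < D - 4 by lra.
have D0 : 0 < D by lra.
(* Numerators and denominators are polynomials in [D] of degree at most 3; [h2] and [h3] bound the
   monomials that [lra] treats as atoms. *)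
have h2 : 0 <= D * (D - 7) by rewrite mulr_ge0 ?subr_ge0 // ltW.
have h3 : 0 <= D * D * (D - 7) by rewrite mulr_ge0 ?subr_ge0 ?mulr_ge0 // ltW.
have quot_itv (x y : R) : 0 <= x -> 0 < y -> x <= y -> 0 <= x / y <= 1.
  by move=> x0 y0 xy; rewrite divr_ge0 ?(ltW y0) //= ler_pdivrMr // mul1r.
rewrite /weight; do 4 (case: ifP => _; first by apply: quot_itv; rewrite ?mulr_gt0 //; lra).
by rewrite ler01 lexx.
Qed.

(** By [sum_anchors_vtype], this is the total weight of the upward cliques through any vector of
    type [s]. *)
Definition coverage (s : seq nat) : R :=
  \sum_(k <- s) weight R d (remove_unit s k).

Lemma sum_nseq1 (F : nat -> R) n : \sum_(k <- nseq n 1%N) F k = n%:R * F 1%N.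
Proof. by rewrite big_nseq iter_addr_0 mulr_natl. Qed.

(** The weights solve a triangular system. Writing w1, w2, w3, w22 for them in the listed order, the
    four partitions give d w1 = 1, w1 + (d - 2) w2 = 1, w2 + (d - 3) w3 = 1 and 2 w2 + (d - 4) w22 =
    1. *)
Lemma coverage_eq1 s : sorted geq s -> all (ltn 0) s -> sumn s = d ->
  (d - 2 <= size s)%N -> coverage s = 1.
Proof.
move=> ss s0 sd sz.
have D7 : 7 <= D by rewrite ler_nat.
have Dn0 : D != 0 by apply/eqP; lra.
have D2n0 : D - 2 != 0 by apply/eqP; lra.
have D3n0 : D - 3 != 0 by apply/eqP; lra.
have D4n0 : D - 4 != 0 by apply/eqP; lra.
have nB k : (k <= 7)%N -> (d - k)%:R = D - k%:R.
  by move=> k7; rewrite natrB //; lia.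
(* Exposes the successor required by the lemmas on [nseq n.+1 1]. *)
have dS k : (k < 7)%N -> (d - k = (d - k.+1).+1)%N by lia.
rewrite /coverage; case: (partition_cases ss s0 sd sz) => ->.
- rewrite sum_nseq1 (_ : nseq d 1%N = nseq (d - 1).+1 1%N); last by congr nseq; lia.
  by rewrite remove_unit_nseq1 weight_1; field.
- rewrite big_cons sum_nseq1 remove_unit_head // (dS 2) // remove_unit_one // -(dS 2) //.
  rewrite weight_2 (_ : 2.-1 :: _ = nseq (d - 1) 1%N) ?weight_1 ?nB //; last by rewrite (dS 1).
  by field; rewrite ?Dn0 ?D2n0.
- rewrite big_cons sum_nseq1 remove_unit_head // (dS 3) // remove_unit_one // -(dS 3) //.
  by rewrite weight_2 weight_3 nB //; field; rewrite ?Dn0 ?D2n0 ?D3n0 ?D4n0.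
rewrite !big_cons sum_nseq1 remove_unit_22_two (dS 4) // remove_unit_22_one -!(dS 4) // -(dS 3) //.
by rewrite weight_2 weight_22 nB //; field; rewrite ?Dn0 ?D2n0 ?D3n0 ?D4n0.
Qed.

Lemma coverage_le s : coverage s <= (size s)%:R.
Proof.
rewrite -sum1_size natr_sum /coverage ler_sum // => k _.
by case/andP: (weight_itv (remove_unit s k)).
Qed.

(** With at most d - 3 parts, a single anchor of weight 1 suffices, and by [weight_small] any anchor
    with at most d - 4 parts is one. *)
Lemma coverage_ge1 s : sorted geq s -> all (ltn 0) s -> sumn s = d -> 1 <= coverage s.
Proof.
move=> ss s0 sd; have [sz|sz] := leqP (d - 2) (size s).
  by rewrite coverage_eq1.
suff [k ks sk] : exists2 k, k \in s & (size (remove_unit s k) <= d - 4)%N.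
  rewrite /coverage (big_rem k) //= weight_small // lerDl sumr_ge0 // => j _.
  by case/andP: (weight_itv (remove_unit s j)).
have [s1|s1] := boolP (1%N \in s).
  by exists 1%N => //; apply: leq_trans (size_remove_unit s1) _; move: (size s) sz => n; lia.
(* Without parts equal to 1 there are at most d / 2 parts, which for d >= 7 is at most d - 4 after
   rounding down; any part may then be lowered. *)
have sz2 : (2 * size s <= sumn s)%N.
  elim: s s0 s1 {ss sd sz} => //= k s IH /andP[k0 /IH{}IH].
  by rewrite inE negb_or => /andP[k1 /IH]; lia.
have ks : head 0%N s \in s by case: (s) sd => [/= d0|k t _]; [lia|exact: mem_head].
exists (head 0%N s) => //; apply: leq_trans (size_remove_unit ks) (leq_trans (leq_subr _ _) _).
by move: sz2; rewrite sd; move: (size s) => n; lia.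
Qed.

End Weights.

(** Such a vector is determined by [m] pairs of a position and the value there, covering all its
    positive coordinates. *)
Lemma card_few_parts q d m :
  (#|[pred x : Delta q.+1 d | size (vtype x) <= m]| <= (q.+1 * d.+1) ^ m)%N.
Proof.
(* Beyond the last positive coordinate the position defaults to [ord0]; it is paired with its true
   value, so the padding carries no false information. *)
pose part (x : Delta q.+1 d) k : 'I_q.+1 :=
  nth ord0 (enum [pred i | 0 < coord x i]%N) k.
pose f (x : Delta q.+1 d) := [ffun k : 'I_m => (part x k, val x (part x k))].
have cardT : #|{: {ffun 'I_m -> 'I_q.+1 * 'I_d.+1}}| = ((q.+1 * d.+1) ^ m)%N.
  by rewrite card_ffun card_prod !card_ord.
rewrite -cardT; apply: (@leq_card_in _ _ f) => x y; rewrite !inE => xm ym fxy.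
have fE k : (k < m)%N -> part x k = part y k /\ coord x (part x k) = coord y (part y k).
  move=> km; move/ffunP: fxy => /(_ (Ordinal km)); rewrite !ffunE => -[e1 e2].
  by split; [exact: e1 | exact: (congr1 (@nat_of_ord _) e2)].
have partP z i : (size (vtype z) <= m)%N -> (0 < coord z i)%N ->
    exists2 k, (k < m)%N & i = part z k.
  move=> zm zi; exists (index i (enum [pred i | 0 < coord z i]%N)).
    by apply: leq_trans zm; rewrite size_vtype cardE index_mem mem_enum.
  by rewrite /part nth_index // mem_enum.
apply: coord_inj => i.
(* A coordinate positive in one vector is listed there, and the other vector lists the same position
   with the same value. *)
have [xi|/(partP x i xm)[k km ->]] := posnP (coord x i); last first.
  by have [e1 ->] := fE k km; rewrite e1.
have [yi|/(partP y i ym)[k km ei]] := posnP (coord y i); first by rewrite xi yi.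
by have [e1 e2] := fE k km; rewrite ei -{1}e1 e2.
Qed.

(** * Lower bound by a proper colouring *)

Lemma leq_coloring_alpha (T : finType) (e : rel T) k (c : T -> 'I_k) :
  (forall x y, e x y -> c x != c y) -> (#|T| <= k * independence_number e)%N.
Proof.
move=> ce; rewrite -sum1_card (partition_big c xpredT) //=.
rewrite -[k in (k * _)%N]card_ord -sum_nat_const; apply: leq_sum => i _.
rewrite sum1dep_card; apply: leq_bigmax_cond.
apply/forall_inP => x; rewrite inE => /eqP xi; apply/forall_inP => y; rewrite inE => /eqP yi.
by apply/negP => /ce; rewrite xi yi eqxx.
Qed.

(** If x - y = e_i - e_j, the colours differ by i - j modulo [q.+1], which is nonzero because i and
    j are distinct and below [q.+1]. *)
Lemma card_Delta_le_alpha q d : (#|{: Delta q.+1 d}| <= q.+1 * alpha q.+1 d)%N.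
Proof.
pose c (x : Delta q.+1 d) : 'I_q.+1 := inord ((\sum_(i < q.+1) i * coord x i) %% q.+1).
apply: (@leq_coloring_alpha _ _ _ c) => x y /adjacentP[i [j [ij e]]].
apply: contraNneq ij => /(congr1 (@nat_of_ord _)); rewrite !inordK ?ltn_mod // => cxy.
have sum_unit (k : 'I_q.+1) : (\sum_(l < q.+1) l * (k == l) = k)%N.
  rewrite (bigD1 k) //= eqxx muln1 big1 ?addn0 // => l; rewrite eq_sym => /negPf->.
  by rewrite muln0.
have : (\sum_(k < q.+1) k * coord x k + j = \sum_(k < q.+1) k * coord y k + i)%N.
  rewrite -{1}(sum_unit j) -{1}(sum_unit i) -!big_split.
  by apply: eq_bigr => k _ /=; rewrite -!mulnDr e.
move=> /(congr1 (modn^~ q.+1)); rewrite -modnDml cxy modnDml => /eqP.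
by rewrite eqn_modDl !modn_small // eq_sym => /eqP/val_inj ->.
Qed.

(** Weak linear programming duality: summing the covering inequalities over an independent set
    counts each anchor at most once, since its clique meets the set in at most one vertex. *)
Lemma alpha_le_cover (R : realType) q d (w : Delta q d -> R) :
  fractional_tile_cover (d := d.+1) w ->
  (alpha q d.+1)%:R <= total_weight (d := d.+1) w.
Proof.
case=> w0 wx.
(* The empty set shows that the maximum runs over a nonempty family, hence is attained. *)
have i0 : independent (@G q d.+1) finset.set0.
  by apply/forall_inP => x; rewrite finset.in_set0.
have i_gt0 : (0 < #|[pred S | independent (@G q d.+1) S]|)%N.
  by apply/card_gt0P; exists finset.set0.
rewrite /alpha /independence_number.
have [S /forall_inP Sind ->] := eq_bigmax_cond (fun S : {set Delta q d.+1} => #|S|) i_gt0.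
rewrite -sum1_card natr_sum.
apply: le_trans (ler_sum _ (fun x _ => wx x)) _.
rewrite (exchange_big_dep xpredT) //=; apply: ler_sum => a _.
rewrite sumr_const -[X in _ <= X]mulr1n ler_wpMn2l //.
rewrite leqNgt; apply/negP => /card_gt1P[x [y [/andP[xS xa] /andP[yS ya] xy]]].
have /forall_inP/(_ y yS) := Sind x xS.
by rewrite (upward_clique_adjacent xa ya xy).
Qed.

(** * Two-sided bounds, with [d.+1] as the degree *)

Section Bounds.
Variables (R : realType) (d : nat).
Hypothesis d_ge7 : (7 <= d.+1)%N.

Lemma cover_vtype q (x : Delta q d.+1) :
  \sum_(a | x \in @upward_clique q d.+1 a) @clique_weight R q d.+1 a =
  coverage R d.+1 (vtype x).
Proof. exact: (sum_anchors_vtype (weight R d.+1)). Qed.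

Lemma clique_weight_cover q : fractional_tile_cover (@clique_weight R q d.+1).
Proof.
split=> [a|x]; first by case/andP: (weight_itv R d_ge7 (vtype a)).
rewrite cover_vtype; apply: coverage_ge1 => //;
  [exact: vtype_sorted | exact: vtype_gt0 | exact: sumn_vtype].
Qed.

(** The first factor bounds the excess coverage of one vector; the second is the part independent of
    q in the count of [card_few_parts]. *)
Let C : R := d.+1%:R * d.+2%:R ^+ (d - 2).

Lemma total_weight_le q :
  total_weight (@clique_weight R q.+1 d.+1) <=
  'C(q + d.+1, d.+1)%:R / q.+1%:R + C * q.+1%:R ^+ (d - 3).
Proof.
have q0 : 0 < q.+1%:R :> R by rewrite ltr0n.
(* After multiplication by [q.+1], the left side is the sum of all coverages. *)
rewrite -(ler_pM2r q0) mulrDl divfK ?gt_eqF // mulr_natr -sum_cliques.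
pose few (x : Delta q.+1 d.+1) := (size (vtype x) <= d - 2)%N.
apply: (@le_trans _ _ (\sum_(x : Delta q.+1 d.+1) (1 + (few x)%:R * d.+1%:R))).
  apply: ler_sum => x _; rewrite cover_vtype /few.
  have [xs|xl] := leqP; last first.
    rewrite mul0r addr0 coverage_eq1 //;
    [exact: vtype_sorted | exact: vtype_gt0 | exact: sumn_vtype | lia].
  rewrite mul1r; apply: le_trans (coverage_le R d_ge7 _) _.
  by rewrite ler_wpDl // ler_nat; lia.
rewrite big_split /= sumr_const card_Delta lerD2l -mulr_suml -natr_sum /C.
have few_le : (\sum_x few x)%:R <= (q.+1%:R * d.+2%:R) ^+ (d - 2) :> R.
  rewrite -natrM -natrX ler_nat; apply: leq_trans (card_few_parts q d.+1 (d - 2)).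
  by rewrite -sum1_card [X in (_ <= X)%N]big_mkcond; apply: leq_sum => x _; rewrite inE /few; case: ifP.
apply: le_trans (ler_wpM2r (ler0n _ _) few_le) _.
by rewrite (_ : (d - 2 = (d - 3).+1)%N) ?exprMn ?exprSr; [lra|lia].
Qed.

Lemma alpha_bounds q :
  (0 : R) <= (alpha q.+1 d.+1)%:R - 'C(q + d.+1, d.+1)%:R / q.+1%:R <= C * q.+1%:R ^+ (d - 3).
Proof.
apply/andP; split.
  rewrite subr_ge0 ler_pdivrMr ?ltr0n // -natrM ler_nat mulnC -card_Delta.
  exact: card_Delta_le_alpha.
rewrite lerBlDl; apply: le_trans (total_weight_le q).
exact: alpha_le_cover (clique_weight_cover _).
Qed.

End Bounds.

(** * Expansion of the average |Delta_q(d)| / q *)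

Lemma ffact_rising n m : ((n + m) ^_ m.+1 = n * \prod_(i < m) (n + i.+1))%N.
Proof.
elim: m => [|m IH]; first by rewrite addn0 ffactn1 big_ord0 muln1.
by rewrite addnS ffactSS IH big_ord_recr /= addnS mulnCA; congr muln; exact: mulnC.
Qed.

(* With M = m + 3 factors, the coefficients are the first two elementary
   symmetric functions of 1, ..., M. *)
Lemma prod_rising_expansion (R : realType) m :
  exists2 B : R, 0 <= B & forall n : nat, (0 < n)%N ->
  let M : R := m.+3%:R in
  `|(\prod_(i < m.+3) (n + i.+1))%:R
    - (n%:R ^+ m.+3 + M * (M + 1) / 2 * n%:R ^+ m.+2
       + (M - 1) * M * (M + 1) * (3 * M + 2) / 24 * n%:R ^+ m.+1)| <= B * n%:R ^+ m.
Proof.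
elim: m => [|m [B B0 IH]].
  (* (n + 1)(n + 2)(n + 3) = n^3 + 6 n^2 + 11 n + 6, so only the constant term remains. *)
  exists 6 => // n _ /=; rewrite !big_ord_recl big_ord0 /= /bump /=.
  rewrite expr0 mulr1 muln1 !natrM !natrD !exprS expr0.
  rewrite [X in `|X|](_ : _ = 6); first by rewrite ger0_norm.
  by field.
pose M : R := m.+3%:R.
pose e2 : R := (M - 1) * M * (M + 1) * (3 * M + 2) / 24.
(* The new factor x + M + 1 is at most (M + 2) x and scales the old error; the second summand
   absorbs the new term of degree [m.+1]. *)
exists (B * (m.+4%:R + 1) + `|(M + 1) * e2|) => [|n n0 /=].
  by rewrite addr_ge0 ?normr_ge0 // mulr_ge0 // addr_ge0 ?ler0n ?ler01.
have Ple := IH n n0; rewrite /= -/M -/e2 in Ple.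
have MS : m.+4%:R = M + 1 :> R by rewrite -natr1.
rewrite big_ord_recr natrM natrD /= MS; move: Ple.
set P := (\prod_(_ < _) _)%:R; set x : R := n%:R => Ple.
have x1 : 1 <= x by rewrite ler1n.
have M0 : 0 <= M by exact: ler0n.
set r := P - _ in Ple.
have -> : P = r + (x ^+ m.+3 + M * (M + 1) / 2 * x ^+ m.+2 + e2 * x ^+ m.+1) by rewrite /r subrK.
(* The higher terms cancel by the recurrences e1(M + 1) = e1(M) + M + 1 and e2(M + 1) = e2(M) + (M +
   1) e1(M) for the elementary symmetric functions. *)
rewrite [X in `|X|](_ : _ = r * (x + (M + 1)) + (M + 1) * e2 * x ^+ m.+1); last first.
  by rewrite /e2 !exprS; field.
apply: le_trans (ler_normD _ _) _; rewrite [X in _ <= X]mulrDl lerD //; last first.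
  by rewrite normrM ler_wpM2l // ger0_norm // exprn_ge0 //; lra.
rewrite normrM; apply: le_trans (ler_wpM2r (normr_ge0 _) Ple) _.
rewrite ger0_norm; last by lra.
rewrite (_ : B * _ * x ^+ m.+1 = B * x ^+ m * ((M + 1 + 1) * x)); last by rewrite exprS; ring.
have x0 : 0 <= x by lra.
by rewrite ler_wpM2l ?mulr_ge0 ?exprn_ge0 //; nra.
Qed.

(** The rising factorial n (n + 1) ... (n + d - 1) has n as its first factor, which cancels. *)
Lemma binom_rising (R : realType) (n d : nat) : (0 < n)%N -> (0 < d)%N ->
  'C(n + d - 1, d)%:R / n%:R = (\prod_(i < d.-1) (n + i.+1))%:R / d`!%:R :> R.
Proof.
case: d => // d n0 _; have nn0 : n%:R != 0 :> R by rewrite pnatr_eq0 -lt0n.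
have fn0 : d.+1`!%:R != 0 :> R by rewrite pnatr_eq0 -lt0n fact_gt0.
rewrite addnS subn1 /=; apply: (mulIf fn0); rewrite divfK // mulrAC -natrM bin_ffact.
by rewrite ffact_rising natrM mulrC mulKf.
Qed.

Theorem theorem9p8 (R : realType) (d : nat) (d_ge7 : (7 <= d)%N) :
  (exists2 C : R, 0 < C &
     \forall q \near \oo,
       let avg : R := 'C(q + d - 1, d)%:R / q%:R in
       0 <= (alpha q d)%:R - avg <= C * q%:R ^+ (d - 4)
       /\ total_weight (@clique_weight R q d) <= avg + C * q%:R ^+ (d - 4))
  /\ ((fun q : nat => (alpha q d)%:R : R) =
      (fun q : nat =>
         q%:R ^+ (d - 1) / d`!%:R
         + q%:R ^+ (d - 2) / (2 * (d - 2)`!%:R)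
         + (3 * d%:R ^+ 2 - 7 * d%:R + 2) / (24 * (d - 2)`!%:R)
             * q%:R ^+ (d - 3))
      +O_\oo (fun q : nat => q%:R ^+ (d - 4) : R))
  /\ (forall q : nat, (2 <= q)%N ->
        fractional_tile_cover (@clique_weight R q d)
        /\ (alpha q d)%:R <= total_weight (@clique_weight R q d)).
Proof.
case: d d_ge7 => [|[|[|[|m]]]] // d_ge7.
pose C : R := m.+4%:R * m.+4.+1%:R ^+ m.+1.
have C0 : 0 < C by rewrite mulr_gt0 ?exprn_gt0 ?ltr0n.
have bounds q : (0 : R) <= (alpha q.+1 m.+4)%:R - 'C(q + m.+4, m.+4)%:R / q.+1%:R
                  <= C * q.+1%:R ^+ m.
  by have := alpha_bounds R d_ge7 q; rewrite !subSS !subn0.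
split; [|split].
- exists C => //; exists 1%N => // -[//|q] _ /=; rewrite addSn subn1 /=.
  rewrite !subSS !subn0; split; first exact: bounds.
  by have := total_weight_le R d_ge7 q; rewrite !subSS !subn0.
- have [B B0 expansion] := prod_rising_expansion R m.
  (* [C] bounds the distance from alpha to the average, [B] the tail of the expansion of the
     average. *)
  apply/eqaddOP/bigO_exP; exists (C + B); first by rewrite ltr_wpDr.
  exists 1%N => // -[//|q] _; rewrite -[X in `|X| <= _]/(_ - (_ + _ + _)).
  have := bounds q; have := @binom_rising R q.+1 m.+4 isT isT; rewrite addSn subn1 /= => ->.
  have /= := expansion q.+1 isT; rewrite !subSS !subn0.
  have -> : m.+4%:R = m.+3%:R + 1 :> R by rewrite -natr1.
  (* Factors d! through (d - 2)!, the factorial in the two lower terms. *)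
  have -> : m.+4`!%:R = (m.+3%:R + 1) * (m.+3%:R * m.+2`!%:R) :> R.
    by rewrite natr1 -!natrM -!factS.
  set P := (\prod_(_ < _) _)%:R; set f : R := m.+2`!%:R.
  set M : R := m.+3%:R; set n : R := q.+1%:R; set A : R := (alpha _ _)%:R.
  have f1 : 1 <= f by rewrite ler1n fact_gt0.
  have M3 : 3 <= M by rewrite ler_nat.
  have n0 : 0 <= n by exact: ler0n.
  clearbody P f M n A.
  have F1 : 1 <= (M + 1) * (M * f) by nra.
  set E := (X in `|P - X|) => Ple /andP[A0 Ale].
  (* [E] divided by d! is the claimed expansion: with d = M + 1, its third coefficient uses (M -
     1)(3 M + 2) = 3 d^2 - 7 d + 2. *)
  rewrite [X in `|X|](_ : _ = A - P / ((M + 1) * (M * f)) + (P - E) / ((M + 1) * (M * f))); last first.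
    rewrite /E !exprS; field. by rewrite !gt_eqF //; lra.
  have nm0 : 0 <= n ^+ m by rewrite exprn_ge0.
  apply: le_trans (ler_normD _ _) _; rewrite [`|n ^+ m|]ger0_norm //.
  rewrite [X in _ <= X]mulrDl [`|A - _|]ger0_norm // lerD //.
  rewrite normrM normfV [`|_ * (M * f)|]ger0_norm; last by apply: le_trans F1.
  by rewrite ler_pdivrMr ?(lt_le_trans _ F1) // (le_trans Ple) // ler_peMr // mulr_ge0.
move=> q _; have cover : fractional_tile_cover (@clique_weight R q m.+4).
  exact: clique_weight_cover.
by split; [exact: cover | exact: alpha_le_cover].
Qed.
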